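(* Let $m,n$ be positive integers. The set $\{\Phi_{a,b,d}\mid 0\le a<m,\ 0\le b<(m,n),\ 0\le d<n\}$ is a complete set of representatives of the normalized $3$-cocycles on $\mathbb{Z}_m\times\mathbb{Z}_n$ with coefficients in $k^*$; that is, each $\Phi_{a,b,d}$ is a normalized $3$-cocycle, and every normalized $3$-cocycle is cohomologous to $\Phi_{a,b,d}$ for exactly one triple $(a,b,d)$ in the indicated range.
   Context: $k$ is an algebraically closed field of characteristic zero and $k^*=k\setminus\{0\}$, regarded as a trivial $\mathbb{Z}_m\times\mathbb{Z}_n$-module. $(m,n)$ denotes the greatest common divisor of $m$ and $n$; $[x]$ denotes the integer part (floor) of a rational number $x$; for each natural number $s$, $\zeta_s\in k$ is a fixed primitive $s$-th root of unity. $g_1$ (resp. $g_2$) is a generator of $\mathbb{Z}_m$ (resp. $\mathbb{Z}_n$), with groups written multiplicatively. Define $$\Phi_{a,b,d}(g_1^ig_2^j,\,g_1^sg_2^t,\,g_1^kg_2^l)=\zeta_m^{a[\frac{k+s}{m}]i}\,\zeta_n^{b[\frac{k+s}{m}]j}\,\zeta_n^{d[\frac{t+l}{n}]j},\qquad 0\le i,s,k<m,\ 0\le j,t,l<n.$$ Cocycles are taken in the bar complex; normalized means taking the value $1$ whenever one of the arguments is the identity. *)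

(* Defs.v *)
From HB Require Import structures.
From mathcomp Require Import all_boot all_order all_algebra all_fingroup all_solvable.

Set Implicit Arguments.
Unset Strict Implicit.
Unset Printing Implicit Defensive.

Import GRing.Theory.
Local Open Scope ring_scope.

(* Degrees 2 and 3 of the bar complex of a group gT with coefficients in the
   trivial module k^*.  A cochain with values in k^* is encoded as a function
   to k that never vanishes. *)
Section BarComplex.
Variables (k : fieldType) (gT : finGroupType).
Implicit Types (f : gT -> gT -> k) (phi psi : gT -> gT -> gT -> k).

Definition cochain2 f := forall x y, f x y != 0.

Definition cochain3 phi := forall x y z, phi x y z != 0.

Definition bar_d2 f (x y z : gT) : k :=
  f y z * (f (x * y)%g z)^-1 * f x (y * z)%g * (f x y)^-1.

Definition bar_d3 phi (x y z w : gT) : k :=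
  phi y z w * (phi (x * y)%g z w)^-1 * phi x (y * z)%g w
  * (phi x y (z * w)%g)^-1 * phi x y z.

Definition cocycle3 phi :=
  cochain3 phi /\ forall x y z w, bar_d3 phi x y z w = 1.

Definition normalized3 phi :=
  forall x y z, x = 1%g \/ y = 1%g \/ z = 1%g -> phi x y z = 1.

Definition normalized_cocycle3 phi := cocycle3 phi /\ normalized3 phi.

Definition cohomologous3 phi psi :=
  exists2 f, cochain2 f &
    forall x y z, phi x y z = psi x y z * bar_d2 f x y z.

End BarComplex.

(* The exponent i of x = g ^+ i with 0 <= i < #[g]; see cyc_expX. *)
Definition cyc_exp (gT : finGroupType) (g x : gT) : nat :=
  index x [seq (g ^+ i)%g | i <- iota 0 #[g]%g].

Lemma cyc_expX (gT : finGroupType) (g : gT) (i : nat) :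
  (i < #[g]%g)%N -> cyc_exp g (g ^+ i)%g = i.
Proof.
move=> lti; rewrite /cyc_exp.
have -> : (g ^+ i)%g = nth 1%g [seq (g ^+ i)%g | i <- iota 0 #[g]%g] i.
  by rewrite (nth_map 0%N) ?size_iota // nth_iota.
rewrite index_uniq ?size_map ?size_iota // map_inj_in_uniq ?iota_uniq //.
move=> u v; rewrite !mem_iota /= !add0n => ltu ltv /eqP.
by rewrite eq_expg_mod_order !modn_small // => /eqP.
Qed.

(* The element g1^i g2^j of the product group is the pair (g1 ^+ i, g2 ^+ j);
   the explicit formula in terms of exponents is PhiE. *)
Definition Phi (k : fieldType) (zeta : nat -> k) (m n : nat)
    (gT1 gT2 : finGroupType) (g1 : gT1) (g2 : gT2) (a b d : nat)
    (x y z : gT1 * gT2) : k :=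
  let i := cyc_exp g1 x.1 in let j := cyc_exp g2 x.2 in
  let s := cyc_exp g1 y.1 in let t := cyc_exp g2 y.2 in
  let k' := cyc_exp g1 z.1 in let l := cyc_exp g2 z.2 in
  zeta m ^+ (a * ((k' + s) %/ m) * i)
  * zeta n ^+ (b * ((k' + s) %/ m) * j)
  * zeta n ^+ (d * ((t + l) %/ n) * j).

Lemma PhiE (k : fieldType) (zeta : nat -> k) (m n : nat)
    (gT1 gT2 : finGroupType) (g1 : gT1) (g2 : gT2) (a b d i j s t k' l : nat) :
    #[g1]%g = m -> #[g2]%g = n ->
    (i < m)%N -> (s < m)%N -> (k' < m)%N ->
    (j < n)%N -> (t < n)%N -> (l < n)%N ->
  Phi zeta m n g1 g2 a b d
      (g1 ^+ i, g2 ^+ j)%g (g1 ^+ s, g2 ^+ t)%g (g1 ^+ k', g2 ^+ l)%g =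
  zeta m ^+ (a * ((k' + s) %/ m) * i)
  * zeta n ^+ (b * ((k' + s) %/ m) * j)
  * zeta n ^+ (d * ((t + l) %/ n) * j).
Proof. by move=> <- <- *; rewrite /Phi /= !cyc_expX. Qed.

(* Main.v *)
(* A normalized 3-cocycle phi on G is a 2-cocycle y, z |-> phi(-, y, z) with
   values in the G-module of functions G -> k^* modulo constants, so it defines
   a group extension of G by that module.  For G = Z_m x Z_n, suppose that the
   two generators have commuting lifts e1, e2 with e1^m = alpha, e2^n = beta for
   characters alpha, beta of G.  Comparing products of the section
   g1^i g2^j |-> e1^i e2^j then shows that phi(x, y, z) is cohomologous to
   alpha(x)^[(k+s)/m] beta(x)^[(t+l)/n], which is Phi_{a,b,d}.  Such lifts are
   obtained by correcting arbitrary ones: N-th roots of functions make e1^m and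
   e2^n powers of the coordinate characters, and the commutator gamma of the
   lifts then has constant row and column products, so that after rescaling it
   can be absorbed into e1 at the cost of a factor zeta_n^{b j} in e1^m.

   Conversely, prod_(s < L) phi(g, g^s, g) with g^L = 1 only depends on the class
   of phi; its values at g1, g2 and g1 g2 recover a, d and b. *)
Require Import Defs.
From HB Require Import structures.
From mathcomp Require Import all_boot all_order all_algebra all_fingroup all_solvable.
From mathcomp Require Import ring zify.

Set Implicit Arguments.
Unset Strict Implicit.
Unset Printing Implicit Defensive.

Import GRing.Theory.
Local Open Scope ring_scope.

(** * The extension of the group by functions modulo constants that a cocycle defines *)

Section ExtensionType.
Variables (k : fieldType) (gT : finGroupType) (phi : gT -> gT -> gT -> k).

(** A class of functions modulo constants is stored as its representative with value 1 at the
    identity. *)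
Definition ext_pred (p : {ffun gT -> k} * gT) :=
  [forall x, p.1 x != 0] && (p.1 1%g == 1).

Record ext (phiP : normalized_cocycle3 phi) :=
  Ext { ext_val : {ffun gT -> k} * gT; _ : ext_pred ext_val }.

Variable phiP : normalized_cocycle3 phi.
HB.instance Definition _ := [isSub for @ext_val phiP].
HB.instance Definition _ := [Choice of ext phiP by <:].

End ExtensionType.

Section Extension.
Variables (k : fieldType) (gT : finGroupType) (phi : gT -> gT -> gT -> k).
Hypothesis phiP : normalized_cocycle3 phi.

Lemma cocycle_neq0 x y z : phi x y z != 0.
Proof. by case: phiP => [[]]. Qed.

Lemma cocycle_eq x y z w :
  phi y z w * phi x (y * z)%g w * phi x y z
  = phi (x * y)%g z w * phi x y (z * w)%g.
Proof.
case: phiP => -[_ /(_ x y z w)]; rewrite /bar_d3 => coc _.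
have := cocycle_neq0 (x * y)%g z w; have := cocycle_neq0 x y (z * w)%g.
set p := phi (x * y)%g z w in coc *; set q := phi x y (z * w)%g in coc * => q0 p0.
by rewrite -[RHS]mulr1 -coc; field; apply/andP.
Qed.

Lemma cocycle_norm x y z : x = 1%g \/ y = 1%g \/ z = 1%g -> phi x y z = 1.
Proof. by case: phiP => _; apply. Qed.

Lemma cocycle1l y z : phi 1%g y z = 1. Proof. by apply: cocycle_norm; left. Qed.
Lemma cocycle1m x z : phi x 1%g z = 1.
Proof. by apply: cocycle_norm; right; left. Qed.
Lemma cocycle1r x y : phi x y 1%g = 1.
Proof. by apply: cocycle_norm; right; right. Qed.

Local Notation ext := (ext phiP).

Definition ext_fun (e : ext) : gT -> k := (val e).1.
Definition ext_base (e : ext) : gT := (val e).2.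

Lemma ext_fun_neq0 e x : ext_fun e x != 0.
Proof. by have /andP[/forallP/(_ x)] := valP e. Qed.

Lemma ext_fun_1 e : ext_fun e 1%g = 1.
Proof. by have /andP[_ /eqP] := valP e. Qed.

Lemma ext_eq e e' : ext_fun e =1 ext_fun e' -> ext_base e = ext_base e' -> e = e'.
Proof.
move=> eqf eqb; apply: val_inj.
move: eqf eqb; rewrite /ext_fun /ext_base; case: (val e) (val e') => [F y] [F' y'] /=.
by move=> /ffunP -> ->.
Qed.

(** The group acts on functions by right translation; dividing the translate by its value at
    [ext_base e] restores the value 1 at the identity. *)
Lemma ext_mul_subproof e e' :
  ext_pred ([ffun x => ext_fun e x
                       * (ext_fun e' (x * ext_base e)%g / ext_fun e' (ext_base e))
                       * phi x (ext_base e) (ext_base e')], (ext_base e * ext_base e')%g).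
Proof.
rewrite /ext_pred /= ffunE ext_fun_1 mul1g divff ?ext_fun_neq0 //.
rewrite cocycle1l !mulr1 eqxx andbT.
by apply/forallP=> x; rewrite ffunE !mulf_neq0 ?invr_eq0 ?ext_fun_neq0 ?cocycle_neq0.
Qed.

Definition ext_mul e e' : ext := @Ext k gT phi phiP _ (ext_mul_subproof e e').

Lemma ext_lift_subproof (g : gT) : @ext_pred k gT ([ffun=> 1], g).
Proof.
rewrite /ext_pred /= ffunE eqxx andbT.
by apply/forallP=> x; rewrite ffunE oner_neq0.
Qed.

Definition ext_lift g : ext := @Ext k gT phi phiP _ (ext_lift_subproof g).

Definition ext_one : ext := ext_lift 1%g.

Lemma ext_fun_mul e e' x : ext_fun (ext_mul e e') x =
  ext_fun e x * (ext_fun e' (x * ext_base e)%g / ext_fun e' (ext_base e))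
  * phi x (ext_base e) (ext_base e').
Proof. by rewrite {1}/ext_fun /= ffunE. Qed.

Lemma ext_fun_one x : ext_fun ext_one x = 1.
Proof. by rewrite /ext_fun /= ffunE. Qed.

(** This is the cocycle identity: its factor [phi y z w], constant in [x], comes from renormalizing
    the translated function of [e' * e'']. *)
Lemma ext_mulA : associative ext_mul.
Proof.
move=> e e' e''; apply: ext_eq => [x|]; last exact: mulgA.
rewrite !ext_fun_mul.
change (ext_base (ext_mul e' e'')) with (ext_base e' * ext_base e'')%g.
change (ext_base (ext_mul e e')) with (ext_base e * ext_base e')%g; rewrite !mulgA.
set y := ext_base e; set z := ext_base e'; set w := ext_base e''.
have nz3 := cocycle_neq0 y z w; have nz4 := cocycle_neq0 x y (z * w)%g.
have -> : phi (x * y)%g z w =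
    phi y z w * phi x (y * z)%g w * phi x y z / phi x y (z * w)%g.
  by rewrite cocycle_eq mulfK.
by field; rewrite !ext_fun_neq0 nz3 nz4.
Qed.

Lemma ext_mul1l : left_id ext_one ext_mul.
Proof.
move=> e; apply: ext_eq => [x|]; last exact: mul1g.
by rewrite ext_fun_mul ext_fun_one cocycle1m mulg1 ext_fun_1 divr1 mul1r mulr1.
Qed.

Lemma ext_mul1r : right_id ext_one ext_mul.
Proof.
move=> e; apply: ext_eq => [x|]; last exact: mulg1.
by rewrite ext_fun_mul !ext_fun_one cocycle1r divr1 !mulr1.
Qed.

HB.instance Definition _ := isMonoid.Build ext ext_mulA ext_mul1l ext_mul1r.

Implicit Types (e : ext) (U V : gT -> k).

Lemma ext_funM e e' x : ext_fun (e * e')%g x =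
  ext_fun e x * (ext_fun e' (x * ext_base e)%g / ext_fun e' (ext_base e))
  * phi x (ext_base e) (ext_base e').
Proof. exact: ext_fun_mul. Qed.

Lemma ext_fun1 x : ext_fun (1%g : ext) x = 1.
Proof. exact: ext_fun_one. Qed.

Lemma ext_baseM e e' : ext_base (e * e')%g = (ext_base e * ext_base e')%g.
Proof. by []. Qed.

Lemma ext_baseX e n : ext_base (e ^+ n)%g = (ext_base e ^+ n)%g.
Proof. by elim: n => // n IHn; rewrite !expgS ext_baseM IHn. Qed.

(* [scal U] is the image of U in the extension; it is the junk value 1 if U has a
   zero. *)
Definition scal U : ext := insubd ext_one ([ffun x => U x / U 1%g], 1%g).

Section Scal.
Variable U : gT -> k.
Hypothesis U_neq0 : forall x, U x != 0.

Lemma val_scal : val (scal U) = ([ffun x => U x / U 1%g], 1%g).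
Proof.
rewrite val_insubd /ext_pred /= ffunE divff ?eqxx ?andbT //.
by case: forallP => // -[] x; rewrite ffunE mulf_neq0 ?invr_eq0.
Qed.

Lemma ext_fun_scal x : ext_fun (scal U) x = U x / U 1%g.
Proof. by rewrite /ext_fun val_scal ffunE. Qed.

Lemma base_scal : ext_base (scal U) = 1%g.
Proof. by rewrite /ext_base val_scal. Qed.

Lemma ext_fun_scalM e x : ext_fun (scal U * e)%g x = U x / U 1%g * ext_fun e x.
Proof.
by rewrite ext_funM base_scal ext_fun_scal mulg1 ext_fun_1 divr1 cocycle1m mulr1.
Qed.

Lemma base_scalM e : ext_base (scal U * e)%g = ext_base e.
Proof. by rewrite ext_baseM base_scal mul1g. Qed.

End Scal.

Lemma eq_scal U V : (forall x, U x != 0) -> (forall x, V x != 0) ->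
  (exists c, forall x, U x = c * V x) -> scal U = scal V.
Proof.
move=> U0 V0 [c Uc]; apply: ext_eq => [x|]; last by rewrite !base_scal.
have c0 : c != 0 by have := U0 1%g; rewrite Uc mulf_eq0 => /norP[].
by rewrite !ext_fun_scal // !Uc -mulf_div divff // mul1r.
Qed.

(** Serves as right cancellation in the monoid: the nonvanishing function of [e] divides out
    pointwise. *)
Lemma scal_inj U V e : (forall x, U x != 0) -> (forall x, V x != 0) ->
  (scal U * e = scal V * e)%g -> forall x, U x / U 1%g = V x / V 1%g.
Proof.
move=> U0 V0 eqUV x; apply: (mulIf (ext_fun_neq0 e x)).
by rewrite -!ext_fun_scalM // eqUV.
Qed.

Lemma scal_ext_fun e : ext_base e = 1%g -> scal (ext_fun e) = e.
Proof.
move=> e1; have nz := ext_fun_neq0 e; apply: ext_eq => [x|]; last by rewrite base_scal.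
by rewrite ext_fun_scal // ext_fun_1 divr1.
Qed.

Lemma scalM U V : (forall x, U x != 0) -> (forall x, V x != 0) ->
  (scal U * scal V)%g = scal (fun x => U x * V x)%R.
Proof.
move=> U0 V0; have UV0 x : U x * V x != 0 by rewrite mulf_neq0.
apply: ext_eq => [x|]; last by rewrite base_scalM // !base_scal.
by rewrite ext_fun_scalM // !ext_fun_scal // mulf_div.
Qed.

(** This is the module action: moving a function to the left past [e] translates it by
    [ext_base e]. *)
Lemma mul_scal e U : (forall x, U x != 0) ->
  (e * scal U)%g = (scal (fun x => U (x * ext_base e)%g) * e)%g.
Proof.
move=> U0; have U0' x : U (x * ext_base e)%g != 0 by [].
apply: ext_eq => [x|]; last by rewrite base_scalM // ext_baseM base_scal // mulg1.
rewrite ext_fun_scalM // ext_funM !ext_fun_scal // base_scal // cocycle1r mul1g mulr1.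
by field; rewrite !U0.
Qed.

(** Each copy of [U] is moved left past the copies of [e] before it, by [mul_scal]. *)
Lemma scalMX e U n : (forall x, U x != 0) ->
  ((scal U * e) ^+ n)%g
  = (scal (fun x => \prod_(i < n) U (x * ext_base e ^+ i)%g)%R * e ^+ n)%g.
Proof.
move=> U0; elim: n => [|n IHn].
  rewrite !expg0 mulg1 -[LHS]scal_ext_fun //; have nz := ext_fun_neq0 (1%g : ext).
  apply: eq_scal => // [x|]; first by rewrite big_ord0 oner_neq0.
  by exists 1 => x; rewrite big_ord0 ext_fun1 mulr1.
have U0P p x : \prod_(i < p) U (x * ext_base e ^+ i)%g != 0.
  by apply/prodf_neq0.
rewrite expgSr IHn -mulgA [(e ^+ n * _)%g]mulgA mul_scal //.
rewrite -mulgA -expgSr mulgA scalM //; congr (_ * _)%g.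
by apply: eq_scal => // [x|]; [rewrite mulf_neq0|exists 1 => x];
  rewrite // mul1r big_ord_recr /= ext_baseX.
Qed.

Lemma same_ext_base e e' : ext_base e = ext_base e' ->
  exists2 U, forall x, U x != 0 & e = (scal U * e')%g.
Proof.
move=> eqb; have nz x : ext_fun e x / ext_fun e' x != 0.
  by rewrite mulf_neq0 ?invr_eq0 ?ext_fun_neq0.
exists (fun x => ext_fun e x / ext_fun e' x) => //; apply: ext_eq => [x|].
  by rewrite ext_fun_scalM // !ext_fun_1 divr1 divr1 divfK ?ext_fun_neq0.
by rewrite base_scalM.
Qed.

End Extension.

(** * Roots in the field and lifts with prescribed powers *)

Lemma nth_root (k : closedFieldType) N : (0 < N)%N ->
  exists r : k -> k, forall x, r x ^+ N = x.
Proof.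
move=> N0; have root x : exists y : k, y ^+ N == x.
  have [y yE] := solve_monicpoly (fun i => if i == 0%N then x else 0) N0.
  exists y; rewrite yE; case: N N0 {yE} => // N _.
  by rewrite big_ord_recl big1 /= ?addr0 ?mulr1 // => i _; rewrite mul0r.
by exists (fun x => xchoose (root x)) => x; apply/eqP/(xchooseP (root x)).
Qed.

Section Twists.
Variables (k : closedFieldType) (gT : finGroupType) (phi : gT -> gT -> gT -> k).
Hypothesis phiP : normalized_cocycle3 phi.
Local Notation ext := (ext phiP).

(* The N-th power alpha of a lift of g satisfies alpha(x g) = alpha(x) alpha(g),
   so alpha(x) / alpha(g) ^ chi(x) is invariant under x |-> x g; multiplying the
   lift by an N-th root of its inverse leaves alpha(g) ^ chi(x). *)
Lemma exists_lift_with_power (g : gT) (N : nat) (chi : gT -> nat) :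
  (0 < N)%N -> (g ^+ N = 1)%g ->
  (forall x, chi (x * g)%g = (chi x + 1)%N %[mod N]) ->
  exists (e : ext) (c : k), [/\ ext_base e = g, c ^+ N = 1 &
    (e ^+ N)%g = scal phiP (fun x => c ^+ chi x)].
Proof.
move=> N0 gN chiP; pose e0 := ext_lift phiP g; pose alpha := ext_fun (e0 ^+ N)%g.
have e0N : (e0 ^+ N)%g = scal phiP alpha by rewrite scal_ext_fun // ext_baseX.
have alpha0 x : alpha x != 0 := ext_fun_neq0 _ x.
have alpha1 : alpha 1%g = 1 := ext_fun_1 _.
set c := alpha g.
have alphaM x : alpha (x * g)%g = alpha x * c.
  have ag0 y : alpha (y * g)%g != 0 by [].
  (* Both sides are [e0 ^+ N.+1], since [e0] commutes with its own power. *)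
  have comm : (scal phiP (fun x => alpha (x * g)%g) * e0 = scal phiP alpha * e0)%g.
    by rewrite -[in RHS]e0N -expgSr expgS e0N mul_scal.
  have /(_ x) := scal_inj ag0 alpha0 comm.
  by rewrite mul1g alpha1 divr1 => <-; rewrite divfK ?alpha0.
have alphaX x s : alpha (x * g ^+ s)%g = alpha x * c ^+ s.
  by elim: s => [|s IHs]; rewrite ?mulg1 ?mulr1 // expgSr mulgA alphaM IHs exprSr mulrA.
have cN : c ^+ N = 1.
  by have := alphaX 1%g N; rewrite gN mulg1 alpha1 mul1r.
have c0 : c != 0 by apply: alpha0.
have [r rK] := nth_root k N0.
pose rho x := c ^+ chi x / alpha x.
have rho0 x : rho x != 0 by rewrite mulf_neq0 ?invr_eq0 ?expf_neq0.
have r0 x : r (rho x) != 0.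
  by apply: contraNneq (rho0 x) => r0; rewrite -(rK (rho x)) r0 expr0n eqn0Ngt N0.
have rhoX x s : rho (x * g ^+ s)%g = rho x.
  elim: s => [|s <-]; first by rewrite mulg1.
  rewrite expgSr mulgA /rho alphaM -(expr_mod _ cN) chiP (expr_mod _ cN) exprD expr1.
  by rewrite -mulf_div divff // mulr1.
exists (scal phiP (fun x => r (rho x)) * e0)%g, c; split=> //.
  by rewrite base_scalM.
have prodE x : \prod_(i < N) r (rho (x * g ^+ i)%g) = rho x.
  under eq_bigr do rewrite rhoX.
  by rewrite prodr_const card_ord rK.
rewrite scalMX // e0N scalM //; last by move=> x; rewrite prodE.
apply: eq_scal => [x|x|]; rewrite ?prodE ?mulf_neq0 ?invr_eq0 ?expf_neq0 //.
by exists 1 => x; rewrite prodE /rho divfK // mul1r.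
Qed.

Lemma scalX (U : gT -> k) n : (forall x, U x != 0) ->
  (scal phiP U ^+ n)%g = scal phiP (fun x => U x ^+ n).
Proof.
move=> U0; elim: n => [|n IHn].
  rewrite -[(_ ^+ 0)%g](@scal_ext_fun _ _ _ phiP) //; apply: eq_scal => [x|x|].
  - exact: ext_fun_neq0.
  - by rewrite expr0 oner_neq0.
  by exists 1 => x; rewrite ext_fun1 mulr1.
rewrite expgS IHn scalM // => [|x]; last by rewrite expf_neq0.
apply: eq_scal => [x|x|]; rewrite ?mulf_neq0 ?expf_neq0 //.
by exists 1 => x; rewrite mul1r exprS.
Qed.

(** Move [e] past [e' ^+ N] in two ways. Passing one factor [e'] at a time collects the product of
    translates of [gamma]; passing [scal A] at once changes nothing, as [A] is invariant under the
    base of [e]. So the product is trivial modulo constants. *)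
Lemma prod_twist_const (e e' : ext) (gamma A : gT -> k) N :
  (forall x, gamma x != 0) -> (forall x, A x != 0) ->
  (e * e' = scal phiP gamma * (e' * e))%g -> (e' ^+ N)%g = scal phiP A ->
  (forall x, A (x * ext_base e)%g = A x) ->
  forall x, \prod_(i < N) gamma (x * ext_base e' ^+ i)%g
            = \prod_(i < N) gamma (ext_base e' ^+ i)%g.
Proof.
move=> g0 A0 ee' e'N Ae.
have P0 x : \prod_(i < N) gamma (x * ext_base e' ^+ i)%g != 0 by apply/prodf_neq0.
have PA0 x : \prod_(i < N) gamma (x * ext_base e' ^+ i)%g * A x != 0 by rewrite mulf_neq0.
have eX s : (e * e' ^+ s = (scal phiP gamma * e') ^+ s * e)%g.
  elim: s => [|s IHs]; first by rewrite !expg0 mulg1 mul1g.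
  by rewrite expgS mulgA ee' mulgA -[in LHS]mulgA IHs [in RHS]expgS -!mulgA.
have AE : scal phiP (fun x => A (x * ext_base e)%g) = scal phiP A.
  by apply: eq_scal => //; exists 1 => x; rewrite Ae mul1r.
have := eX N; rewrite scalMX // e'N mul_scal // AE scalM // => /scal_inj-/(_ A0 PA0) Pc x.
rewrite -[RHS](eq_bigr _ (fun i _ => congr1 gamma (mul1g _))).
have A10 : A x / A 1%g != 0 by rewrite mulf_neq0 ?invr_eq0.
by apply/divr1_eq/(mulIf A10); rewrite mul1r mulf_div Pc.
Qed.

End Twists.

(** * Exponents in cyclic groups and coordinates on their product *)

Section Cyclic.
Variables (gT : finGroupType) (g : gT) (N : nat).
Hypotheses (cardG : #|[set: gT]| = N) (genG : generator [set: gT] g).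

Lemma order_generator : #[g]%g = N.
Proof. by rewrite -cardG (eqP genG). Qed.

Lemma cyc_exp_lt x : (cyc_exp g x < N)%N.
Proof.
have /cyclePmin[i lti ->] : x \in <[g]>%g by rewrite -(eqP genG) inE.
by rewrite cyc_expX // -order_generator.
Qed.

Lemma expg_cyc_exp x : (g ^+ cyc_exp g x)%g = x.
Proof.
have /cyclePmin[i lti ->] : x \in <[g]>%g by rewrite -(eqP genG) inE.
by rewrite cyc_expX.
Qed.

Lemma cyc_exp_mod i : cyc_exp g (g ^+ i)%g = (i %% N)%N.
Proof.
rewrite -order_generator -expg_mod_order cyc_expX // ltn_mod.
exact: order_gt0.
Qed.

Lemma cyc_expM x y : cyc_exp g (x * y)%g = ((cyc_exp g x + cyc_exp g y) %% N)%N.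
Proof. by rewrite -{1}(expg_cyc_exp x) -{1}(expg_cyc_exp y) -expgD cyc_exp_mod. Qed.

Lemma cyc_exp1 : cyc_exp g 1%g = 0%N.
Proof. by rewrite -(expg0 g) cyc_exp_mod mod0n. Qed.

End Cyclic.

Section Product.
Variables (m n : nat) (gT1 gT2 : finGroupType) (g1 : gT1) (g2 : gT2).
Hypotheses (m_gt0 : (0 < m)%N) (n_gt0 : (0 < n)%N).
Hypotheses (card1 : #|[set: gT1]| = m) (gen1 : generator [set: gT1] g1).
Hypotheses (card2 : #|[set: gT2]| = n) (gen2 : generator [set: gT2] g2).
Local Notation G := (gT1 * gT2)%type.

Definition chi1 (x : G) := cyc_exp g1 x.1.
Definition chi2 (x : G) := cyc_exp g2 x.2.
Definition h1 : G := (g1, 1%g).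
Definition h2 : G := (1%g, g2).

Lemma chi1_lt x : (chi1 x < m)%N. Proof. exact: cyc_exp_lt. Qed.
Lemma chi2_lt x : (chi2 x < n)%N. Proof. exact: cyc_exp_lt. Qed.

Lemma chi1M x y : chi1 (x * y)%g = ((chi1 x + chi1 y) %% m)%N.
Proof. exact: (cyc_expM card1 gen1). Qed.
Lemma chi2M x y : chi2 (x * y)%g = ((chi2 x + chi2 y) %% n)%N.
Proof. exact: (cyc_expM card2 gen2). Qed.

Lemma expg_pair (x : gT1) (y : gT2) i : (((x, y) : G) ^+ i = (x ^+ i, y ^+ i))%g.
Proof. by elim: i => // i IHi; rewrite !expgS IHi. Qed.

Lemma h1X i : (h1 ^+ i)%g = (g1 ^+ i, 1)%g.
Proof. by rewrite expg_pair expg1n. Qed.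
Lemma h2X i : (h2 ^+ i)%g = (1, g2 ^+ i)%g.
Proof. by rewrite expg_pair expg1n. Qed.

Lemma chi1_1 : chi1 1%g = 0%N. Proof. exact: (cyc_exp1 card1 gen1). Qed.
Lemma chi2_1 : chi2 1%g = 0%N. Proof. exact: (cyc_exp1 card2 gen2). Qed.
Lemma chi1_h1X i : chi1 (h1 ^+ i)%g = (i %% m)%N.
Proof. by rewrite h1X; exact: (cyc_exp_mod card1 gen1). Qed.
Lemma chi2_h2X i : chi2 (h2 ^+ i)%g = (i %% n)%N.
Proof. by rewrite h2X; exact: (cyc_exp_mod card2 gen2). Qed.
Lemma chi1_h2X i : chi1 (h2 ^+ i)%g = 0%N.
Proof. by rewrite h2X; exact: (cyc_exp1 card1 gen1). Qed.
Lemma chi2_h1X i : chi2 (h1 ^+ i)%g = 0%N.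
Proof. by rewrite h1X; exact: (cyc_exp1 card2 gen2). Qed.

Lemma chiK x : (h1 ^+ chi1 x * h2 ^+ chi2 x)%g = x.
Proof.
rewrite h1X h2X; case: x => x1 x2; congr (_, _) => /=.
  by rewrite mulg1 (expg_cyc_exp gen1).
by rewrite mul1g (expg_cyc_exp gen2).
Qed.

Lemma h1m : (h1 ^+ m = 1)%g.
Proof. by rewrite h1X -(order_generator card1 gen1) expg_order. Qed.
Lemma h2n : (h2 ^+ n = 1)%g.
Proof. by rewrite h2X -(order_generator card2 gen2) expg_order. Qed.

Lemma h12C i j : (h1 ^+ i * h2 ^+ j = h2 ^+ j * h1 ^+ i)%g.
Proof.
by apply: commuteX2; rewrite /commute; congr (_, _); rewrite /= ?mulg1 ?mul1g.
Qed.

Lemma chi1_hX i j : chi1 (h1 ^+ i * h2 ^+ j)%g = (i %% m)%N.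
Proof. by rewrite chi1M chi1_h1X chi1_h2X addn0 modn_mod. Qed.
Lemma chi2_hX i j : chi2 (h1 ^+ i * h2 ^+ j)%g = (j %% n)%N.
Proof. by rewrite chi2M chi2_h1X chi2_h2X add0n modn_mod. Qed.

(** * The cocycles [Phi] and the invariants that separate their classes *)

Section Cocycles.
Variables (k : fieldType) (zeta : nat -> k).
Hypothesis zetaP : forall s : nat, (0 < s)%N -> s.-primitive_root (zeta s).

Lemma zeta_neq0 s i : (0 < s)%N -> zeta s ^+ i != 0.
Proof.
move=> s0; rewrite expf_neq0 //; apply: contra_eq_neq (prim_expr_order (zetaP s0)).
by move=> ->; rewrite expr0n eqn0Ngt s0 eq_sym oner_neq0.
Qed.

(** A character of the product group: the overview's alpha is [qchar a b] and its beta is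
    [qchar 0 d]. *)
Definition qchar a b x := zeta m ^+ (a * chi1 x) * zeta n ^+ (b * chi2 x).

Lemma qchar_neq0 a b x : qchar a b x != 0.
Proof. by rewrite mulf_neq0 ?zeta_neq0. Qed.

Lemma qcharM a b x y : qchar a b (x * y)%g = qchar a b x * qchar a b y.
Proof.
have mod s u v w : (0 < s)%N ->
    zeta s ^+ (u * ((v + w) %% s)) = zeta s ^+ (u * v) * zeta s ^+ (u * w).
  move=> s0; rewrite -exprD -mulnDr mulnC exprM (prim_expr_mod (zetaP s0)).
  by rewrite -exprM mulnC.
by rewrite /qchar chi1M chi2M !mod // mulrACA.
Qed.

Lemma qchar1 a b : qchar a b 1%g = 1.
Proof. by rewrite /qchar chi1_1 chi2_1 !muln0 mulr1. Qed.

Lemma Phi_qchar a b d x y z : Phi zeta m n g1 g2 a b d x y z =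
  qchar a b x ^+ ((chi1 y + chi1 z) %/ m) * qchar 0 d x ^+ ((chi2 y + chi2 z) %/ n).
Proof.
rewrite /Phi /qchar mul0n mul1r exprMn -!exprM.
rewrite -/(chi1 x) -/(chi2 x) -/(chi1 z) -/(chi1 y) -/(chi2 z) -/(chi2 y) [(chi1 z + _)%N]addnC.
by rewrite ![(_ * chi1 x * _)%N]mulnAC ![(_ * chi2 x * _)%N]mulnAC.
Qed.

(** For positive [N] both sides are the total carry [(u + v + w) %/ N]; for [N = 0] all quotients
    are 0 by convention. *)
Lemma divn_carry N u v w :
  (((v + w) %/ N) + (u + (v + w) %% N) %/ N
   = ((u + v) %/ N) + ((u + v) %% N + w) %/ N)%N.
Proof.
have [->|N0] := posnP N; first by rewrite !divn0.
by rewrite -!divnMDl // !addnA addnAC -!divn_eq addnC addnA.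
Qed.

(** [Phi] is multiplicative in its first argument ([PM]) and, through the carries, a 2-cocycle in
    the other two ([PA]). *)
Lemma Phi_cocycle a b d : normalized_cocycle3 (Phi zeta m n g1 g2 a b d).
Proof.
split; [split=> [x y z|x y z w]|move=> x y z].
- by rewrite Phi_qchar mulf_neq0 ?expf_neq0 ?qchar_neq0.
- pose P := Phi zeta m n g1 g2 a b d.
  have P0 u v t : P u v t != 0.
    by rewrite /P Phi_qchar mulf_neq0 ?expf_neq0 ?qchar_neq0.
  have PM : P (x * y)%g z w = P x z w * P y z w.
    by rewrite /P !Phi_qchar !qcharM !(exprMn _ (qchar _ _ _) (qchar _ _ _)) mulrACA.
  have PA : P x z w * P x y (z * w)%g = P x y z * P x (y * z)%g w.
    rewrite /P !Phi_qchar mulrACA -!exprD [RHS]mulrACA -!exprD !chi1M !chi2M.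
    by rewrite -!divn_carry.
  rewrite /bar_d3 -/P PM; have -> : P x (y * z)%g w = P x z w * P x y (z * w)%g / P x y z.
    by rewrite PA mulrC mulKf.
  by field; rewrite !P0.
rewrite Phi_qchar => -[->|[->|->]]; first by rewrite !qchar1 !expr1n mulr1.
  by rewrite chi1_1 chi2_1 !add0n !divn_small ?chi1_lt ?chi2_lt ?mulr1.
by rewrite chi1_1 chi2_1 !addn0 !divn_small ?chi1_lt ?chi2_lt ?mulr1.
Qed.

(** A counter modulo [N] advanced [L] times overflows once every [N] steps. *)
Lemma sum_carry N L : (1 < N)%N -> (\sum_(s < L) (s %% N + 1) %/ N = L %/ N)%N.
Proof.
move=> N1; elim: L => [|L IHL]; first by rewrite big_ord0 div0n.
by rewrite big_ord_recr /= IHL -divnMDl ?addnA -?divn_eq ?addn1 // ltnW.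
Qed.

Lemma prod_Phi a b d g L : \prod_(s < L) Phi zeta m n g1 g2 a b d g (g ^+ s)%g g =
  qchar a b g ^+ (\sum_(s < L) (chi1 (g ^+ s)%g + chi1 g) %/ m)%N
  * qchar 0 d g ^+ (\sum_(s < L) (chi2 (g ^+ s)%g + chi2 g) %/ n)%N.
Proof.
by under eq_bigr do rewrite Phi_qchar; rewrite big_split /= -!expr_sum.
Qed.

Lemma prod_Phi_h1 a b d : (1 < m)%N ->
  \prod_(s < m) Phi zeta m n g1 g2 a b d h1 (h1 ^+ s)%g h1 = zeta m ^+ a.
Proof.
(* For [m = 1] this exponent would be 0. *)
move=> m1; have c1 : chi1 h1 = 1%N by rewrite -[h1]expg1 chi1_h1X modn_small.
have c2 : chi2 h1 = 0%N by rewrite -[h1]expg1 chi2_h1X.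
rewrite prod_Phi /qchar c1 c2 !muln0 ?mul0n !mulr1 muln1 expr1n mulr1.
under eq_bigr do rewrite chi1_h1X.
by rewrite sum_carry // divnn m_gt0.
Qed.

Lemma prod_Phi_h2 a b d : (1 < n)%N ->
  \prod_(s < n) Phi zeta m n g1 g2 a b d h2 (h2 ^+ s)%g h2 = zeta n ^+ d.
Proof.
move=> n1; have c1 : chi1 h2 = 0%N by rewrite -[h2]expg1 chi1_h2X.
have c2 : chi2 h2 = 1%N by rewrite -[h2]expg1 chi2_h2X modn_small.
rewrite prod_Phi /qchar c1 c2 !muln0 ?mul0n !mul1r !muln1.
under eq_bigr do rewrite chi1_h2X div0n.
under [in X in _ * X]eq_bigr do rewrite chi2_h2X.
by rewrite sum_carry // divnn n_gt0 big1 // mul1r.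
Qed.

Lemma prod_Phi_h12 a b d : (1 < m)%N -> (1 < n)%N -> let L := lcmn m n in
  \prod_(s < L) Phi zeta m n g1 g2 a b d (h1 * h2)%g ((h1 * h2) ^+ s)%g (h1 * h2)%g
  = (zeta m ^+ a * zeta n ^+ b) ^+ (L %/ m) * zeta n ^+ d ^+ (L %/ n).
Proof.
move=> m1 n1 L.
have hX s : ((h1 * h2) ^+ s = h1 ^+ s * h2 ^+ s)%g.
  by apply: expgMn; have := h12C 1 1; rewrite !expg1.
have c1 : chi1 (h1 * h2)%g = 1%N by rewrite -[h1]expg1 -[h2]expg1 chi1_hX modn_small.
have c2 : chi2 (h1 * h2)%g = 1%N by rewrite -[h1]expg1 -[h2]expg1 chi2_hX modn_small.
rewrite prod_Phi /qchar c1 c2 mul0n mul1r !muln1.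
under eq_bigr do rewrite hX chi1_hX.
under [in X in _ * X]eq_bigr do rewrite hX chi2_hX.
by rewrite !sum_carry.
Qed.

(** Along the powers of [g] the coboundary of [f] is the quotient [F s.+1 / F s]; the product
    telescopes to [F L / F 0], which is 1 because [g ^+ L = 1]. *)
Lemma prod_cohomologous (phi psi : G -> G -> G -> k) g L :
  (g ^+ L = 1)%g -> cohomologous3 phi psi ->
  \prod_(s < L) phi g (g ^+ s)%g g = \prod_(s < L) psi g (g ^+ s)%g g.
Proof.
move=> gL [f f0 phiE].
pose F s := f g (g ^+ s)%g / f (g ^+ s)%g g.
under eq_bigr do rewrite phiE.
rewrite big_split /= -[RHS]mulr1; congr (_ * _).
rewrite (eq_bigr (fun s : 'I_L => F s.+1 / F s)) => [|s _].
  have [->|L0] := posnP L; first by rewrite big_ord0.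
  rewrite -(big_mkord xpredT (fun s => F s.+1 / F s)) telescope_prodf //.
    by rewrite /F gL expg0 divff // mulf_neq0 ?invr_eq0.
  by move=> s _; rewrite /F mulf_neq0 ?invr_eq0.
rewrite /bar_d2 /F -expgS -expgSr; field.
by rewrite !f0.
Qed.

Lemma Phi_inj phi a b d a' b' d' :
    (a < m)%N -> (b < gcdn m n)%N -> (d < n)%N ->
    (a' < m)%N -> (b' < gcdn m n)%N -> (d' < n)%N ->
    cohomologous3 phi (Phi zeta m n g1 g2 a b d) ->
    cohomologous3 phi (Phi zeta m n g1 g2 a' b' d') ->
  [/\ a = a', b = b' & d = d'].
Proof.
move=> am bg dn am' bg' dn' coh coh'.
have eqI g L : (g ^+ L = 1)%g ->
    \prod_(s < L) Phi zeta m n g1 g2 a b d g (g ^+ s)%g g =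
    \prod_(s < L) Phi zeta m n g1 g2 a' b' d' g (g ^+ s)%g g.
  by move=> gL; rewrite -(prod_cohomologous gL coh) (prod_cohomologous gL coh').
have aE : a = a'.
  have [m1|m1] := leqP m 1; first by lia.
  have := eqI _ _ h1m; rewrite !prod_Phi_h1 // => /eqP.
  by rewrite (eq_prim_root_expr (zetaP m_gt0)) !modn_small // => /eqP.
have dE : d = d'.
  have [n1|n1] := leqP n 1; first by lia.
  have := eqI _ _ h2n; rewrite !prod_Phi_h2 // => /eqP.
  by rewrite (eq_prim_root_expr (zetaP n_gt0)) !modn_small // => /eqP.
split=> //; rewrite -{}aE -{}dE in coh' eqI *.
(* If [m] or [n] is 1, so is their gcd, and [b] and [b'] are both 0. *)
have [m1|m1] := leqP m 1.
  have m_eq1 : m = 1%N by lia.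
  by move: bg bg'; rewrite m_eq1 gcd1n; case: (b) (b') => [|?] [|?].
have [n1|n1] := leqP n 1.
  have n_eq1 : n = 1%N by lia.
  by move: bg bg'; rewrite n_eq1 gcdn1; case: (b) (b') => [|?] [|?].
have hL : ((h1 * h2) ^+ lcmn m n = 1)%g.
  rewrite expgMn; last by have := h12C 1 1; rewrite !expg1.
  rewrite -{1}(divnK (dvdn_lcml m n)) -{2}(divnK (dvdn_lcmr m n)).
  by rewrite ![(_ %/ _ * _)%N]mulnC !expgnA h1m h2n !expg1n mul1g.
(* The equal contributions of [d] and then of [a] cancel, leaving powers of [zeta n] with exponents
   [b] and [b'] times [lcmn m n %/ m]. *)
have := eqI _ _ hL; rewrite !prod_Phi_h12 // => /mulIf.
rewrite expf_neq0 ?zeta_neq0 // => /(_ isT); rewrite !exprMn => /mulfI.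
rewrite expf_neq0 ?zeta_neq0 // => /(_ isT); rewrite -!exprM => /eqP.
rewrite (eq_prim_root_expr (zetaP n_gt0)).
have L0 : (0 < lcmn m n %/ m)%N.
  by rewrite divn_gt0 // dvdn_leq ?dvdn_lcml // lcmn_gt0 m_gt0.
(* Congruence modulo [n] of these multiples is thus congruence of [b] and [b'] modulo [gcdn m n]. *)
have nE : n = (gcdn m n * (lcmn m n %/ m))%N.
  apply/eqP; rewrite -(eqn_pmul2r m_gt0) -mulnA divnK ?dvdn_lcml //.
  by rewrite [(gcdn _ _ * _)%N]mulnC muln_lcm_gcd mulnC.
by rewrite {2 4}nE -!muln_modl !modn_small // eqn_pmul2r // => /eqP.
Qed.

End Cocycles.

(** * Commuting lifts and the existence of a representative *)

Section Existence.
Variables (k : closedFieldType) (zeta : nat -> k).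
Hypothesis zetaP : forall s : nat, (0 < s)%N -> s.-primitive_root (zeta s).
Variable phi : G -> G -> G -> k.
Hypothesis phiP : normalized_cocycle3 phi.
Local Notation ext := (ext phiP).

Lemma cohomologous_of_lifts (e1 e2 : ext) a b d :
  ext_base e1 = h1 -> ext_base e2 = h2 -> commute e1 e2 ->
  (e1 ^+ m)%g = scal phiP (qchar zeta a b) ->
  (e2 ^+ n)%g = scal phiP (qchar zeta 0 d) ->
  cohomologous3 phi (Phi zeta m n g1 g2 a b d).
Proof.
move=> be1 be2 e12 e1m e2n.
set alpha := qchar zeta a b in e1m; set beta := qchar zeta 0 d in e2n.
have alpha0 x : alpha x != 0 by apply: (qchar_neq0 zetaP).
have beta0 x : beta x != 0 by apply: (qchar_neq0 zetaP).
pose sigma y : ext := (e1 ^+ chi1 y * e2 ^+ chi2 y)%g.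
have bsigma y : ext_base (sigma y) = y by rewrite ext_baseM !ext_baseX be1 be2 chiK.
have e12X i j : (e2 ^+ j * e1 ^+ i = e1 ^+ i * e2 ^+ j)%g by rewrite commuteX2.
(* As the lifts commute, exponents add; each carry splits off a factor [e1 ^+ m] or [e2 ^+ n]. *)
have sigmaM y z : (sigma y * sigma z)%g =
    (scal phiP (fun x => alpha x ^+ ((chi1 y + chi1 z) %/ m)
       * beta x ^+ ((chi2 y + chi2 z) %/ n))%R * sigma (y * z))%g.
  rewrite -(@scalM _ _ _ phiP (fun x => alpha x ^+ _) (fun x => beta x ^+ _));
    [|by move=> x; rewrite expf_neq0 ..].
  rewrite -!scalX // -e1m -e2n.
  rewrite /sigma !chi1M !chi2M -!expgnA.
  rewrite mulgA -[(_ * e1 ^+ chi1 z)%g]mulgA e12X mulgA -expgnDr -mulgA -expgnDr.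
  rewrite {1}(divn_eq (chi1 y + chi1 z) m) {1}(divn_eq (chi2 y + chi2 z) n).
  rewrite ![(_ %/ _ * _)%N]mulnC !expgnDr -!mulgA; congr (_ * _)%g.
  by rewrite !mulgA e12X.
(* The cochain reads off the section; [sigmaM] evaluated at [x] is the required relation. *)
exists (fun x y => ext_fun (sigma y) x) => [x y|x y z]; first exact: ext_fun_neq0.
have := congr1 (fun e : ext => ext_fun e x) (sigmaM y z).
have nz u : alpha u ^+ ((chi1 y + chi1 z) %/ m) * beta u ^+ ((chi2 y + chi2 z) %/ n) != 0.
  by apply: mulf_neq0; apply: expf_neq0.
rewrite ext_fun_scalM // ext_funM !bsigma.
rewrite /alpha /beta !qchar1 !expr1n mulr1 divr1 -Phi_qchar => eqs.
rewrite /bar_d2; move: eqs; set Ph := Phi _ _ _ _ _ _ _ _ _ _ _ => eqs.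
have -> : phi x y z = Ph * ext_fun (sigma (y * z)%g) x
     / (ext_fun (sigma y) x * (ext_fun (sigma z) (x * y)%g / ext_fun (sigma z) y)).
  by rewrite -eqs mulrC mulKf // !mulf_neq0 ?invr_eq0 ?ext_fun_neq0.
by field; rewrite !ext_fun_neq0.
Qed.

(** Together with [prod_h2_const], this computes the product of [gamma] over the whole group in two
    ways, so that [r ^+ n = q ^+ m]. *)
Lemma prod_h1_const (gamma : G -> k) r :
  (forall x, \prod_(i < m) gamma (x * h1 ^+ i)%g = r) ->
  \prod_(j < n) \prod_(i < m) gamma (h2 ^+ j * h1 ^+ i)%g = r ^+ n.
Proof.
by move=> gr; under eq_bigr do rewrite gr; rewrite prodr_const card_ord.
Qed.

Lemma prod_h2_const (gamma : G -> k) q :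
  (forall x, \prod_(j < n) gamma (x * h2 ^+ j)%g = q) ->
  \prod_(j < n) \prod_(i < m) gamma (h2 ^+ j * h1 ^+ i)%g = q ^+ m.
Proof.
move=> gq; rewrite exchange_big /=.
under eq_bigr do under eq_bigr do rewrite -h12C.
by under eq_bigr do rewrite gq; rewrite prodr_const card_ord.
Qed.

(* The factor lambda makes all column products of gamma trivial; its ambiguity by
   n-th roots of unity changes the row products by m-th powers of these, which is
   why the exponent b only matters modulo gcdn m n. *)
Lemma exists_rescaling (gamma : G -> k) r q :
    (forall x, gamma x != 0) ->
    (forall x, \prod_(i < m) gamma (x * h1 ^+ i)%g = r) ->
    (forall x, \prod_(j < n) gamma (x * h2 ^+ j)%g = q) ->
  exists (lambda : k) (b : 'I_(gcdn m n)),
    [/\ lambda != 0, lambda ^+ n * q = 1 & (lambda ^+ m * r)^-1 = zeta n ^+ b].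
Proof.
move=> g0 gr gq; have zn := zetaP n_gt0.
have q0 : q != 0 by rewrite -(gq 1%g); apply/prodf_neq0.
have rq : r ^+ n = q ^+ m by rewrite -(prod_h1_const gr) (prod_h2_const gq).
have [root rootK] := nth_root k n_gt0; pose l0 := root q^-1.
have l0n : l0 ^+ n * q = 1 by rewrite rootK mulVf.
have l00 : l0 != 0.
  by apply: contraNneq (oner_neq0 k) => l00; rewrite -l0n l00 expr0n eqn0Ngt n_gt0 mul0r.
have : (l0 ^+ m * r)^-1 ^+ n = 1.
  by rewrite exprVn exprMn exprAC rq -exprMn l0n expr1n invr1.
case/(prim_rootP zn) => u uE.
have d0 : (0 < gcdn m n)%N by rewrite gcdn_gt0 m_gt0.
(* Here [gcdn m n + a * m = a' * n]; dividing [l0] by [zeta n ^+ (a * t)] adds [a * t * m] to [u],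
   which reduces it modulo [n] to [u %% gcdn m n]. *)
have [a _ /dvdnP[a' aE]] := Bezoutl m n_gt0.
rewrite gcdnC in aE; pose t := (u %/ gcdn m n)%N.
exists (l0 * (zeta n ^+ (a * t))^-1), (Ordinal (ltn_pmod u d0)); split.
- by rewrite mulf_neq0 ?invr_eq0 ?(zeta_neq0 zetaP).
- by rewrite exprMn exprVn exprAC (prim_expr_order zn) expr1n invr1 mulr1.
rewrite exprMn mulrAC invfM uE exprVn invrK -exprM -exprD /=.
have -> : (u + a * t * m = a' * t * n + u %% gcdn m n)%N.
  rewrite {1}(divn_eq u (gcdn m n)) -/t -[RHS]addnC addnAC addnC; congr (_ + _)%N.
  by rewrite [(a' * t)%N]mulnC -[RHS]mulnA -aE mulnDr [(a * t)%N]mulnC mulnA.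
by rewrite exprD exprM exprAC (prim_expr_order zn) expr1n mul1r.
Qed.

(** A discrete antiderivative of [gamma] in the direction [h2]: the product starts at second
    exponent 0 and stops just before [x]. *)
Definition column_part (gamma : G -> k) (x : G) :=
  \prod_(t < chi2 x) gamma ((x.1, 1) * h2 ^+ t)%g.

Lemma pair_chi2 (x : G) : (((x.1, 1) : G) * h2 ^+ chi2 x)%g = x.
Proof.
rewrite h2X; case: x => x1 x2; congr (_, _); rewrite /= ?mulg1 ?mul1g //.
exact: (expg_cyc_exp gen2).
Qed.

Lemma column_part_h2 gamma x : (forall x, gamma x != 0) ->
  (forall x, \prod_(j < n) gamma (x * h2 ^+ j)%g = 1) ->
  column_part gamma (x * h2)%g = column_part gamma x * gamma x.
Proof.
move=> g0 gq; rewrite /column_part.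
have -> : (x * h2)%g.1 = x.1 by exact: mulg1.
pose F t := gamma ((x.1, 1) * h2 ^+ t)%g.
have -> : gamma x = F (chi2 x) by rewrite /F pair_chi2.
rewrite -(big_mkord xpredT F) -(big_mkord xpredT F) -big_nat_recr //=.
rewrite -[h2]expg1 chi2M chi2_h2X modnDmr addn1.
(* At the wrap-around [chi2 x = n - 1] the left side is empty and the right side is a full column,
   of product 1. *)
have := chi2_lt x; rewrite leq_eqVlt => /orP[/eqP-> | lt].
  by rewrite modnn big_nil big_mkord gq.
by rewrite modn_small.
Qed.

(** Exchanging the products, each of the [chi2 x] rows contributes [r]. *)
Lemma column_part_h1 gamma r x :
  (forall x, \prod_(i < m) gamma (x * h1 ^+ i)%g = r) ->
  \prod_(i < m) column_part gamma (x * h1 ^+ i)%g = r ^+ chi2 x.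
Proof.
move=> gr; rewrite /column_part.
have E i : chi2 (x * h1 ^+ i)%g = chi2 x.
  by rewrite chi2M chi2_h1X addn0 modn_small ?chi2_lt.
under eq_bigr do rewrite E.
rewrite exchange_big /= -[in RHS](card_ord (chi2 x)) -prodr_const.
apply: eq_bigr => t _; rewrite -(gr ((x.1, 1) * h2 ^+ t)%g).
apply: eq_bigr => i _; congr gamma; rewrite -mulgA -h12C mulgA; congr (_ * _)%g.
by rewrite h1X; congr (_, _); rewrite /= mulg1.
Qed.

Lemma exists_lifts : exists (e1 e2 : ext) (a : 'I_m) (b : 'I_(gcdn m n)) (d : 'I_n),
  [/\ ext_base e1 = h1, ext_base e2 = h2, commute e1 e2,
   (e1 ^+ m)%g = scal phiP (qchar zeta a b)
   & (e2 ^+ n)%g = scal phiP (qchar zeta 0 d)].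
Proof.
have chi1h x : chi1 (x * h1)%g = (chi1 x + 1)%N %[mod m].
  by rewrite -[h1]expg1 chi1M chi1_h1X modn_mod modnDmr.
have chi2h x : chi2 (x * h2)%g = (chi2 x + 1)%N %[mod n].
  by rewrite -[h2]expg1 chi2M chi2_h2X modn_mod modnDmr.
have [e1 [c [be1 cm e1m]]] := exists_lift_with_power phiP m_gt0 h1m chi1h.
have [e2 [c' [be2 cn e2n]]] := exists_lift_with_power phiP n_gt0 h2n chi2h.
have [a aE] := prim_rootP (zetaP m_gt0) cm; rewrite {c}aE in e1m {cm}.
have [d dE] := prim_rootP (zetaP n_gt0) cn; rewrite {c'}dE in e2n {cn}.
have [gamma g0 e21] : exists2 U,
    forall x, U x != 0 & (e2 * e1 = scal phiP U * (e1 * e2))%g.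
  by apply: same_ext_base; rewrite !ext_baseM be1 be2 -[h1]expg1 -[h2]expg1 h12C.
have gV0 x : (gamma x)^-1 != 0 by rewrite invr_eq0.
have e12 : (e1 * e2 = scal phiP (fun x => (gamma x)^-1)%R * (e2 * e1))%g.
  rewrite e21 mulgA scalM // -[LHS](mul1g _); congr (_ * _)%g.
  rewrite -[LHS](@scal_ext_fun _ _ _ phiP) //; apply: eq_scal => [x|x|].
  - exact: ext_fun_neq0.
  - by rewrite mulVf ?oner_neq0.
  by exists 1 => x; rewrite ext_fun1 mulVf ?mulr1.
have A0 x : zeta m ^+ a ^+ chi1 x != 0 by rewrite expf_neq0 ?(zeta_neq0 zetaP).
have B0 x : zeta n ^+ d ^+ chi2 x != 0 by rewrite expf_neq0 ?(zeta_neq0 zetaP).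
have gr x : \prod_(i < m) gamma (x * h1 ^+ i)%g = \prod_(i < m) gamma (h1 ^+ i)%g.
  rewrite -be1; apply: (prod_twist_const g0 A0 e21 e1m) => y.
  by rewrite be2 -[h2]expg1 chi1M chi1_h2X addn0 modn_small ?chi1_lt.
have gq x : \prod_(i < n) gamma (x * h2 ^+ i)%g = \prod_(i < n) gamma (h2 ^+ i)%g.
  (* The lifts exchange roles here, which inverts their commutator. *)
  apply: invr_inj; rewrite -!prodfV -be2.
  apply: (prod_twist_const gV0 B0 e12 e2n) => y.
  by rewrite be1 -[h1]expg1 chi2M chi2_h1X addn0 modn_small ?chi2_lt.
move: gr gq; set r := \prod_(i < m) _; set q := \prod_(i < n) _ => gr gq.
have [l [b [l0 ln lm]]] := exists_rescaling g0 gr gq.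
(* A constant factor does not change the commutator, since [scal] ignores it. *)
pose gamma' x := l * gamma x.
have g'0 x : gamma' x != 0 by rewrite mulf_neq0.
have g'r x : \prod_(i < m) gamma' (x * h1 ^+ i)%g = l ^+ m * r.
  by rewrite big_split /= prodr_const card_ord gr.
have g'q x : \prod_(i < n) gamma' (x * h2 ^+ i)%g = 1.
  by rewrite big_split /= prodr_const card_ord gq.
(* Then [U x = l * (U (x * h2) * gamma x)], so [scal U * e1] commutes with [e2]; the row products of
   [U] put the factor [zeta n ^+ (b * chi2 x)] into its [m]-th power. *)
pose U x := (column_part gamma' x)^-1.
have U0 x : U x != 0 by rewrite invr_eq0; apply/prodf_neq0.
have prodU x : \prod_(i < m) U (x * h1 ^+ i)%g = zeta n ^+ (b * chi2 x).
  by rewrite prodfV (column_part_h1 _ g'r) -exprVn lm exprM.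
exists (scal phiP U * e1)%g, e2, a, b, d; split=> //.
- by rewrite base_scalM.
- rewrite /commute [RHS]mulgA mul_scal // -[RHS]mulgA e21 -[LHS]mulgA [RHS]mulgA scalM //.
  congr (_ * _)%g; apply: eq_scal => // [x|]; first by rewrite mulf_neq0.
  exists l => x; rewrite be2 /U column_part_h2 // /gamma'.
  have : column_part gamma' x != 0 by rewrite -invr_eq0; exact: U0.
  by move=> c0; field; rewrite g0 l0 c0.
- rewrite scalMX // be1 e1m scalM // => [|x]; last by rewrite prodU zeta_neq0.
  apply: eq_scal => [x|x|];
    rewrite ?prodU ?(qchar_neq0 zetaP) ?mulf_neq0 ?(zeta_neq0 zetaP) //.
  by exists 1 => x; rewrite prodU mul1r mulrC -exprM.
- rewrite e2n; apply: eq_scal => // [x|]; first exact: (qchar_neq0 zetaP).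
  by exists 1 => x; rewrite /qchar mul0n exprM !mul1r.
Qed.

End Existence.
End Product.

Theorem proposition3p9
    (k : closedFieldType) (char0 : [pchar k] =i pred0)
    (zeta : nat -> k)
    (zetaP : forall s : nat, (0 < s)%N -> s.-primitive_root (zeta s))
    (m n : nat) (m_gt0 : (0 < m)%N) (n_gt0 : (0 < n)%N)
    (gT1 gT2 : finGroupType) (g1 : gT1) (g2 : gT2)
    (card1 : #|[set: gT1]| = m) (gen1 : generator [set: gT1] g1)
    (card2 : #|[set: gT2]| = n) (gen2 : generator [set: gT2] g2) :
  (forall (a : 'I_m) (b : 'I_(gcdn m n)) (d : 'I_n),
     normalized_cocycle3 (Phi zeta m n g1 g2 a b d)) /\
  (forall phi : gT1 * gT2 -> gT1 * gT2 -> gT1 * gT2 -> k,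
     normalized_cocycle3 phi ->
     exists! abd : 'I_m * 'I_(gcdn m n) * 'I_n,
       cohomologous3 phi (Phi zeta m n g1 g2 abd.1.1 abd.1.2 abd.2)).
Proof.
split=> [a b d|phi phiP]; first exact: Phi_cocycle.
have [e1 [e2 [a [b [d [be1 be2 e12 e1m e2n]]]]]] :=
  exists_lifts m_gt0 n_gt0 card1 gen1 card2 gen2 zetaP phiP.
have coh : cohomologous3 phi (Phi zeta m n g1 g2 a b d).
  exact: (cohomologous_of_lifts m_gt0 n_gt0 card1 gen1 card2 gen2 zetaP be1 be2).
exists (a, b, d); split=> // -[[a' b'] d'] /= coh'.
have [eqa eqb eqd] := Phi_inj m_gt0 n_gt0 card1 gen1 card2 gen2 zetaP
  (ltn_ord a) (ltn_ord b) (ltn_ord d) (ltn_ord a') (ltn_ord b') (ltn_ord d') coh coh'.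
by congr (_, _, _); apply: val_inj.
Qed.
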